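(* Let $K\ge2$ be an integer, $\alpha\in(0,1)$, and let $\varphi_1^{\mathrm{in}},\dots,\varphi_K^{\mathrm{in}}\in C^{1,\alpha}(\mathbb{T}^2)$ be real-valued functions. Define the disjoint open sets $$\Omega_k=\{x\in\mathbb{T}^2:\ \varphi_k^{\mathrm{in}}(x)>\varphi_j^{\mathrm{in}}(x)\ \text{for all }j\ne k\},\qquad k=1,\dots,K,$$ and assume that their union covers $\mathbb{T}^2$ up to a set of measure zero. Assume also that there are constants $\delta>0$ and $m>0$ such that for every pair $i\ne j$, $$|\nabla(\varphi_i^{\mathrm{in}}-\varphi_j^{\mathrm{in}})(x)|\ge m\quad\text{for all }x\in\{|\varphi_i^{\mathrm{in}}-\varphi_j^{\mathrm{in}}|\le\delta\}\cap\mathcal{T}_{ij},$$ where $$\mathcal{T}_{ij}=\{x\in\mathbb{T}^2:\ \varphi_i^{\mathrm{in}}(x)\ge\varphi_\ell^{\mathrm{in}}(x)\ \text{and}\ \varphi_j^{\mathrm{in}}(x)\ge\varphi_\ell^{\mathrm{in}}(x)\ \text{for all }\ell\ne i,j\}.$$ For $c_1,\dots,c_K\in\mathbb{R}$ and $\beta>0$ put $$\omega_0^\beta(x)=\sum_{k=1}^K c_k\,\frac{e^{\beta\varphi_k^{\mathrm{in}}(x)}}{\sum_{j=1}^K e^{\beta\varphi_j^{\mathrm{in}}(x)}},\qquad \omega_0(x)=\sum_{k=1}^K c_k\,\mathbf{1}_{\Omega_k}(x).$$ Then there exists a constant $C>0$, depending on $K$, $\delta$, $m$ and the $C^{1,\alpha}$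 geometry of the sets $\Omega_k$ (that is, on the markers, but not on $\beta$ or on $c_1,\dots,c_K$), such that for all $\beta\ge1$, $$\|\omega_0^\beta-\omega_0\|_{L^1(\mathbb{T}^2)}\le\frac{C}{\beta}\,\max_{1\le i,j\le K}|c_i-c_j|.$$
   Context: $\mathbb{T}^2$ is the two-dimensional flat torus with Lebesgue measure. $\mathbf{1}_A$ denotes the indicator function of $A$. *)

(* Defs.v *)
From HB Require Import structures.
From mathcomp Require Import all_boot all_order all_algebra.
From mathcomp Require Import all_classical all_reals all_analysis.

Set Implicit Arguments.
Unset Strict Implicit.
Unset Printing Implicit Defensive.

Import Order.TTheory GRing.Theory Num.Theory.
Import numFieldNormedType.Exports.

Local Open Scope classical_set_scope.
Local Open Scope ring_scope.

(* The flat torus is R^2/Z^2.  A function on it is a Z^2-periodic function on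
   the plane, a subset of it is the Z^2-invariant preimage in the plane, and
   its Lebesgue measure is planar Lebesgue measure on the fundamental domain
   [0,1[ x [0,1[. *)

Definition torus_periodic (R : realType) (f : R * R -> R) : Prop :=
  forall (x : R * R) (p q : int), f (x.1 + p%:~R, x.2 + q%:~R) = f x.

Definition fundamental_domain (R : realType) : set (R * R) :=
  `[0, 1[ `*` `[0, 1[.

Lemma measurable_fundamental_domain (R : realType) :
  measurable (@fundamental_domain R : set (measurableTypeR R * measurableTypeR R)).
Proof. by apply: measurableX; exact: measurable_itv. Qed.

(* measurableTypeR R is R itself; naming it is what lets the measure structure of
   the restricted product be inferred. *)
Definition torus_measure (R : realType) :
    {measure set (measurableTypeR R * measurableTypeR R) -> \bar R} :=
  mrestr (@lebesgue_measure R \x @lebesgue_measure R)%E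
    (@measurable_fundamental_domain R).

(* The library norm on R * R is the sup norm. *)
Definition enorm (R : realType) (v : R * R) : R :=
  Num.sqrt (v.1 ^+ 2 + v.2 ^+ 2).

Definition grad (R : realType) (f : R * R -> R) (x : R * R) : R * R :=
  ('D_((1, 0) : R * R) f x, 'D_((0, 1) : R * R) f x).

(* The torus distance is the minimum of the Euclidean distances between lifts,
   so quantifying over all pairs of points of the plane gives exactly the
   Hoelder condition on the torus.  The bounds on f and on its gradient need not
   be required: they follow from continuity and periodicity. *)
Definition C1alpha_torus (R : realType) (alpha : R) (f : R * R -> R) : Prop :=
  [/\ torus_periodic f,
      forall x : R * R, differentiable f x
    & exists H : R, forall x y : R * R,
        enorm (grad f x - grad f y) <= H * enorm (x - y) `^ alpha].

Section Markers.
Context (R : realType) (K : nat) (phi : 'I_K -> R * R -> R).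

Definition Omega (k : 'I_K) : set (R * R) :=
  [set x | forall j : 'I_K, j != k -> phi j x < phi k x].

Definition top_pair (i j : 'I_K) : set (R * R) :=
  [set x | forall l : 'I_K, l != i -> l != j ->
     phi l x <= phi i x /\ phi l x <= phi j x].

Definition omega0_beta (c : 'I_K -> R) (beta : R) (x : R * R) : R :=
  \sum_(k < K) c k * (expR (beta * phi k x) /
                      \sum_(j < K) expR (beta * phi j x)).

Definition omega0 (c : 'I_K -> R) (x : R * R) : R :=
  \sum_(k < K) c k * \1_(Omega k) x.

End Markers.

Definition max_jump (R : realType) (K : nat) (c : 'I_K -> R) : R :=
  \big[Num.max/0]_(i < K) \big[Num.max/0]_(j < K) `|c i - c j|.

(* Main.v *)
(** On [Omega_k] the smoothing error is at most
    [K max|c_i - c_j| exp (- beta (phi_k - phi_j))], where [phi_j] is the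
    largest of the other markers, so that the point lies in [T_kj].  It remains
    to bound the integral of [exp (- beta |g|)], [g = phi_k - phi_j], over
    [T_kj] by [C / beta].  Cut the fundamental domain into squares so small that
    the partial derivatives of [g] vary by at most [m / 4] on each of them.  If
    a square meets [T_kj] inside [{|g| <= delta}], then one and the same partial
    derivative of [g] is at least [m / 4] in absolute value on the whole square;
    on every slice in that direction the mean value theorem yields
    [|g| >= m |t - a| / 8] for some [a], so the integral over the slice is
    [O(1 / beta)], and Tonelli's theorem gives the same bound on the square.  On
    any other square, [exp (- beta |g|) <= exp (- beta delta)
    <= 1 / (beta delta)] on [T_kj]. *)
Require Import Defs.
From HB Require Import structures.
From mathcomp Require Import all_boot all_order all_algebra.
From mathcomp Require Import all_classical all_reals all_analysis.
From mathcomp Require Import measurable_realfun.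
From mathcomp Require Import ring lra.
Set Implicit Arguments.
Unset Strict Implicit.
Unset Printing Implicit Defensive.
Import Order.TTheory GRing.Theory Num.Theory.
Import numFieldNormedType.Exports.
Local Open Scope classical_set_scope.
Local Open Scope ring_scope.

(** * Borel measurability on the plane *)

(** Rational squares inside [U] cover [U], and there are countably many. The union runs over all
    rational triples (centre and half-width); a square not contained in [U] is replaced by the empty
    set. *)
Lemma open_measurable_prod (R : realType) (U : set (R * R)) :
  open U -> measurable (U : set (measurableTypeR R * measurableTypeR R)).
Proof.
move=> oU.
pose box (q : rat * rat * rat) : set (R * R) :=
  `](ratr q.1.1 - ratr q.2), (ratr q.1.1 + ratr q.2)[ `*`
  `](ratr q.1.2 - ratr q.2), (ratr q.1.2 + ratr q.2)[.
pose cell q : set (R * R) := if `[< box q `<=` U >] then box q else set0.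
have -> : U = \bigcup_q cell q.
  rewrite eqEsubset; split => [[x y] Uxy|z [q _]]; last first.
    by rewrite /cell; case: asboolP => // bU /bU.
  move: oU; rewrite openE => /(_ _ Uxy) /nbhs_ballP[e /= e0 beU].
  have [r] := @rat_in_itvoo R 0 (e / 2) ltac:(by rewrite divr_gt0).
  rewrite in_itv/= => /andP[r0 re].
  have [p] := @rat_in_itvoo R (x - ratr r) (x + ratr r) ltac:(lra).
  rewrite in_itv/= => /andP[p1 p2].
  have [q] := @rat_in_itvoo R (y - ratr r) (y + ratr r) ltac:(lra).
  rewrite in_itv/= => /andP[q1 q2].
  exists (p, q, r) => //; rewrite /cell; case: asboolP => [_|[]].
    by split; rewrite /= in_itv/=; apply/andP; split; lra.
  move=> [u v] [] /=; rewrite !in_itv/= => /andP[u1 u2] /andP[v1 v2].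
  by apply: beU; split => /=; rewrite /ball/= ltr_norml; apply/andP; split; lra.
apply: countable_bigcupT_measurable => // q.
rewrite /cell; case: ifP => // _.
by apply: measurableX; exact: measurable_itv.
Qed.

Lemma continuous_measurable_prod (R : realType) (f : R * R -> R) :
  continuous f ->
  measurable_fun [set: measurableTypeR R * measurableTypeR R]
    (f : _ -> measurableTypeR R).
Proof.
move=> /continuousP cf; apply: (measurability _ (RGenOpens.measurableE R)).
move=> _ [_ [a [b ->] <-]]; rewrite setTI; apply: open_measurable_prod.
exact/cf/interval_open.
Qed.

(** * Exponential integrals on a segment without critical points *)

(** Square [1 + |t|/2 <= exp (|t|/2)] and drop the cross term. The Cauchy kernel has an explicit
    antiderivative that is smooth across 0, so later integrals need no splitting at the kink of
    [|t|]. *)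
Lemma expRN_le_Cauchy (R : realType) (t : R) :
  expR (- `|t|) <= (1 + (t / 2) ^+ 2)^-1.
Proof.
rewrite expRN lef_pV2 ?posrE ?expR_gt0//; last by rewrite ltr_pwDl// sqr_ge0.
have -> : `|t| = `|t| / 2 + `|t| / 2 by rewrite -splitr.
have h := expR_ge1Dx (`|t| / 2).
have h0 : 0 <= `|t| / 2 by rewrite divr_ge0.
rewrite expRD; apply: (@le_trans _ _ ((1 + `|t| / 2) * (1 + `|t| / 2))).
  rewrite !exprMn -(real_normK (num_real t)) -!exprMn; nra.
by rewrite ler_pM// ?addr_ge0.
Qed.

Lemma continuous_Cauchy (R : realType) (k a : R) :
  continuous (fun x : R => (1 + (k * (x - a)) ^+ 2)^-1).
Proof.
move=> x; apply: cvgV; first by rewrite gt_eqF// ltr_pwDl// sqr_ge0.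
apply: cvgD; first exact: cvg_cst.
have h : (fun x => k * (x - a)) @ x --> k * (x - a).
  by apply: cvgM; [exact: cvg_cst|apply: cvgB => //; exact: cvg_cst].
exact: (cvgM h h).
Qed.

(** The antiderivative [atan (k (x - a)) / k] has total variation [pi / k], whatever the segment and
    the centre. *)
Lemma integral_Cauchy_le (R : realType) (k a p q : R) : 0 < k -> p < q ->
  (\int[lebesgue_measure]_(x in `[p, q]) (1 + (k * (x - a)) ^+ 2)^-1%:E
     <= (pi / k)%:E)%E.
Proof.
move=> k0 pq.
pose F := (k^-1 \*: (@atan R \o (fun x => k * (x - a)))) : R -> R.
have dF (x : R) : is_derive x (1 : R) F (1 + (k * (x - a)) ^+ 2)^-1.
  rewrite /F.
  have h : is_derive x (1 : R) (fun x => k * (x - a)) k.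
    apply: is_derive_eq. by rewrite subr0 /GRing.scale/= mulr1 // .
  apply: is_derive_eq.
  by rewrite /GRing.scale/= mulrCA mulVf ?gt_eqF// mulr1.
have cF (x : R) : {for x, continuous F}.
  by apply: differentiable_continuous; apply/derivable1_diffP; case: (dF x).
rewrite (@continuous_FTC2 _ _ F)//.
- rewrite -EFinB lee_fin /F /= /GRing.scale/= -mulrBr mulrC.
  rewrite ler_pM2r ?invr_gt0//.
  have := @atan_ltpi2 R (k * (q - a)).
  by have := @atan_gtNpi2 R (k * (p - a)); lra.
- by apply: continuous_subspaceT; exact: continuous_Cauchy.
- split.
  + by move=> x _; case: (dF x).
  + exact/cvg_at_right_filter/cF.
  + exact/cvg_at_left_filter/cF.
- by move=> x _; rewrite derive1E; exact: derive_val.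
Qed.

(* The minimizer [a] of [|h|] on the segment satisfies
   [|h x - h a| <= 2 |h x|], so no zero of [h] is needed. *)
Lemma noncritical_lower_bound (R : realType) (h dh : R -> R) (mu p q : R) :
  (forall x, is_derive x (1 : R) h (dh x)) -> p < q ->
  (forall x, x \in `[p, q] -> mu <= `|dh x|) ->
  exists a, forall x, x \in `[p, q] -> mu / 2 * `|x - a| <= `|h x|.
Proof.
move=> hdh pq hmu.
have ch (x : R) : {for x, continuous h}.
  by apply: differentiable_continuous; apply/derivable1_diffP; case: (hdh x).
have [|a apq amin] := @EVT_min R (fun x => `|h x|) p q (ltW pq).
  apply: continuous_subspaceT => x.
  by apply: continuous_comp (ch x) _; exact: norm_continuous.
exists a => x xpq.
(* The mean value theorem makes [h] expand distances by at least [mu]. *)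
have expand (s t : R) : s \in `[p, q] -> t \in `[p, q] -> s < t ->
    mu * (t - s) <= `|h t - h s|.
  move=> spq tpq st.
  have [c cst ->] := MVT st (fun y _ => hdh y) (continuous_subspaceT ch).
  rewrite normrM (gtr0_norm (_ : 0 < t - s)) ?subr_gt0// ler_pM2r ?subr_gt0//.
  apply: hmu; move: cst spq tpq; rewrite !in_itv/= => /andP[sc ct] /andP[ps _].
  by move=> /andP[_ tq]; apply/andP; split; lra.
have {}expand : mu * `|x - a| <= `|h x - h a|.
  have [xa|ax|->] := ltgtP x a; last by rewrite !subrr !normr0 mulr0.
  - by rewrite distrC (distrC (h x)) gtr0_norm ?subr_gt0// expand.
  - by rewrite gtr0_norm ?subr_gt0// expand.
have := ler_normB (h x) (h a); have /= := amin _ xpq; lra.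
Qed.

Lemma integral_exp_noncritical_le (R : realType) (h dh : R -> R)
    (mu beta p q : R) :
  (forall x, is_derive x (1 : R) h (dh x)) -> p < q -> 0 < mu -> 0 < beta ->
  (forall x, x \in `[p, q] -> mu <= `|dh x|) ->
  (\int[lebesgue_measure]_(x in `[p, q]) (expR (- (beta * `|h x|)))%:E
     <= (4 * pi / mu / beta)%:E)%E.
Proof.
move=> hdh pq mu0 beta0 hmu.
have [a ha] := noncritical_lower_bound hdh pq hmu.
(* One factor 1/2 comes from the lower bound [mu / 2 * |x - a|], the other from [t / 2] in the
   Cauchy kernel. *)
pose k := beta * mu / 4.
have k0 : 0 < k by rewrite /k divr_gt0 ?mulr_gt0.
have -> : 4 * pi / mu / beta = pi / k.
  by rewrite /k; field; rewrite !gt_eqF.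
apply: le_trans (integral_Cauchy_le a k0 pq).
have ch : continuous h.
  move=> x; apply: differentiable_continuous; apply/derivable1_diffP.
  by case: (hdh x).
apply: ge0_le_integral => //=.
- apply/measurable_EFinP; apply: measurable_funTS => /=.
  apply: measurableT_comp => //; apply: measurableT_comp => //.
  apply: measurable_funM => //; apply: measurableT_comp => //.
  exact: continuous_measurable_fun.
- apply/measurable_EFinP; apply: measurable_funTS => /=.
  by apply: continuous_measurable_fun; exact: continuous_Cauchy.
- move=> x xpq; rewrite lee_fin.
  have := expRN_le_Cauchy (beta * (mu / 2) * (x - a)).
  have -> : beta * (mu / 2) * (x - a) / 2 = k * (x - a) by rewrite /k; field.
  apply: le_trans; rewrite ler_expR lerN2 normrM.
  rewrite (gtr0_norm (_ : 0 < beta * (mu / 2))); last by rewrite !mulr_gt0.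
  by rewrite -mulrA ler_pM2l// ha.
Qed.

(** * Integrals over boxes by slicing *)

Definition box (R : realType) (p q r s : R) : set (R * R) :=
  `[p, q] `*` `[r, s].

Lemma measurable_box (R : realType) (p q r s : R) :
  measurable (box p q r s : set (measurableTypeR R * measurableTypeR R)).
Proof. by apply: measurableX; exact: measurable_itv. Qed.

(** The outer integration in Tonelli's theorem: [I] is the integral over a slice, bounded by [c] on
    a segment of length at most 1 and zero elsewhere. *)
Lemma integral_section_le (R : realType) (I : R -> \bar R) (c r s : R) :
  measurable_fun setT I -> 0 <= c -> r <= s -> s - r <= 1 ->
  (forall y, y \notin `[r, s] -> I y = 0%E) ->
  (forall y, y \in `[r, s] -> (0 <= I y <= c%:E)%E) ->
  (\int[lebesgue_measure]_y I y <= c%:E)%E.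
Proof.
move=> mI c0 rs sr1 I0 Ic.
have -> : (\int[lebesgue_measure]_y I y
    = \int[lebesgue_measure]_(y in `[r, s]) I y)%E.
  rewrite [RHS]integral_mkcond; apply: eq_integral => y _.
  by rewrite patchE; case: ifPn => // /negP; rewrite inE => /negP/I0.
apply: (@le_trans _ _ (\int[lebesgue_measure]_(y in `[r, s]) (cst c%:E y))%E).
  apply: ge0_le_integral => //=.
  - by move=> y /Ic/andP[].
  - exact: measurable_funTS.
  - by move=> y /Ic/andP[].
have mrs : lebesgue_measure (`[r, s] : set R) = (s - r)%:E.
  rewrite lebesgue_measure_itv/= lte_fin; case: ltP => [_|sr].
    by rewrite -EFinB.
  by congr EFin; lra.
rewrite integral_cst//= [X in (_ * X)%E](_ : _ = (s - r)%:E)//.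
by rewrite -EFinM lee_fin ler_piMr.
Qed.

(** The difference quotient of [g] in direction [(1, 0)] and that of its horizontal section are the
    same function of [h]. *)
Lemma is_derive_section1 (R : realType) (g : R * R -> R) (x y : R) :
  differentiable g (x, y) ->
  is_derive x (1 : R) (fun t => g (t, y)) ('D_((1, 0) : R * R) g (x, y)).
Proof.
move=> /(@diff_derivable _ _ _ _ _ ((1, 0) : R * R)).
have E : (fun h : R => h^-1 *: ((g \o shift (x, y)) (h *: ((1, 0) : R * R))
                                - g (x, y)))
       = (fun h : R => h^-1 *: (((fun t => g (t, y)) \o shift x) (h *: (1 : R))
                                - g (x, y))).
  by apply/funext => h /=; congr (_ *: (g _ - _)); congr pair;
    rewrite /= scaler0 add0r.
by rewrite /derivable E => dg; apply: DeriveDef => //; rewrite /derive E.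
Qed.

Lemma is_derive_section2 (R : realType) (g : R * R -> R) (x y : R) :
  differentiable g (x, y) ->
  is_derive y (1 : R) (fun t => g (x, t)) ('D_((0, 1) : R * R) g (x, y)).
Proof.
move=> /(@diff_derivable _ _ _ _ _ ((0, 1) : R * R)).
have E : (fun h : R => h^-1 *: ((g \o shift (x, y)) (h *: ((0, 1) : R * R))
                                - g (x, y)))
       = (fun h : R => h^-1 *: (((fun t => g (x, t)) \o shift y) (h *: (1 : R))
                                - g (x, y))).
  by apply/funext => h /=; congr (_ *: (g _ - _)); congr pair;
    rewrite /= scaler0 add0r.
by rewrite /derivable E => dg; apply: DeriveDef => //; rewrite /derive E.
Qed.

Section box_integral.
Context (R : realType) (g : R * R -> R) (mu beta p q r s : R).
Hypotheses (dg : forall z, differentiable g z) (mu0 : 0 < mu)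
  (beta0 : 0 < beta) (pq : p < q) (pq1 : q - p <= 1)
  (rs : r < s) (rs1 : s - r <= 1).

(** Extension by zero turns the integral over the box into one over the plane, the form in which
    Tonelli's theorem is applied. *)
Let f := (fun z : measurableTypeR R * measurableTypeR R =>
  (expR (- (beta * `|g z|)))%:E) \_ (box p q r s).

Let f_ge0 z : (0 <= f z)%E.
Proof. by rewrite /f patchE; case: ifP => //; rewrite lee_fin expR_ge0. Qed.

Lemma measurable_fun_expRN_norm :
  measurable_fun [set: measurableTypeR R * measurableTypeR R]
    (fun z => expR (- (beta * `|g z|)) : measurableTypeR R).
Proof.
have cg : continuous g by move=> z; exact: differentiable_continuous.
apply: measurableT_comp => //; apply: measurableT_comp => //.
apply: measurable_funM => //; apply: measurableT_comp => //.
exact: continuous_measurable_prod.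
Qed.

Let mf : measurable_fun [set: measurableTypeR R * measurableTypeR R] f.
Proof.
apply/(measurable_restrictT _ _).1; first exact: measurable_box.
by apply/measurable_EFinP; apply: measurable_funTS;
  exact: measurable_fun_expRN_norm.
Qed.

Let c0 : 0 <= 4 * pi / mu / beta.
Proof. by rewrite !divr_ge0 ?mulr_ge0 ?pi_ge0// ltW. Qed.

Let section1 x y :
  f (x, y) = if y \in `[r, s] then
    ((fun t => (expR (- (beta * `|g (t, y)|)))%:E) \_ `[p, q]) x else 0%E.
Proof.
rewrite /f !patchE /box in_setX/= !mem_setE.
by case: (y \in _); rewrite ?andbF ?andbT.
Qed.

Let section2 x y :
  f (x, y) = if x \in `[p, q] then
    ((fun t => (expR (- (beta * `|g (x, t)|)))%:E) \_ `[r, s]) y else 0%E.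
Proof.
rewrite /f !patchE /box in_setX/= !mem_setE.
by case: (x \in _); rewrite ?andbF ?andbT.
Qed.

(** Integrate first in the first variable: every horizontal slice has derivative at least [mu] in
    absolute value, so the one-dimensional bound holds uniformly in [y]. *)
Lemma integral_box_exp_le1 :
  (forall z, box p q r s z -> mu <= `|'D_((1, 0) : R * R) g z|) ->
  (\int[lebesgue_measure \x lebesgue_measure]_(z in box p q r s)
     (expR (- (beta * `|g z|)))%:E <= (4 * pi / mu / beta)%:E)%E.
Proof.
move=> gmu; rewrite integral_mkcond (fubini_tonelli2 _ mf f_ge0).
apply: (@integral_section_le _ _ _ r s) => //.
- exact: measurable_fun_fubini_tonelli_G.
- exact: ltW.
- move=> y yrs; rewrite /fubini_G; apply: integral0_eq => x _.
  by rewrite section1 (negbTE yrs).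
- move=> y yrs; rewrite /fubini_G integral_ge0//=.
  under eq_integral do rewrite section1 yrs.
  rewrite -integral_mkcond.
  apply: (integral_exp_noncritical_le
    (fun x => is_derive_section1 (dg (x, y))) pq mu0 beta0) => x xpq.
  by apply: gmu; split.
Qed.

Lemma integral_box_exp_le2 :
  (forall z, box p q r s z -> mu <= `|'D_((0, 1) : R * R) g z|) ->
  (\int[lebesgue_measure \x lebesgue_measure]_(z in box p q r s)
     (expR (- (beta * `|g z|)))%:E <= (4 * pi / mu / beta)%:E)%E.
Proof.
move=> gmu; rewrite integral_mkcond (fubini_tonelli1 _ mf f_ge0).
apply: (@integral_section_le _ _ _ p q) => //.
- exact: measurable_fun_fubini_tonelli_F.
- exact: ltW.
- move=> x xpq; rewrite /fubini_F; apply: integral0_eq => y _.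
  by rewrite section2 (negbTE xpq).
- move=> x xpq; rewrite /fubini_F integral_ge0//=.
  under eq_integral do rewrite section2 xpq.
  rewrite -integral_mkcond.
  apply: (integral_exp_noncritical_le
    (fun y => is_derive_section2 (dg (x, y))) rs mu0 beta0) => y yrs.
  by apply: gmu; split.
Qed.

End box_integral.

(** * Grid of small cells and majorants on them *)

(** Supplies the mesh: [2 / N] bounds the diameter of a cell, so a Hölder function oscillates by at
    most [e] on each cell. *)
Lemma small_powR (R : realType) (alpha H e : R) : 0 < alpha -> 0 < e ->
  exists N : nat, (0 < N)%N /\
    forall d, 0 <= d <= 2 / N%:R -> H * d `^ alpha <= e.
Proof.
move=> alpha0 e0; have H0 : 0 < `|H| + 1 by rewrite ltr_wpDl.
(* [H] may be zero or negative, hence [|H| + 1] in the denominator. *)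
pose d0 := (e / (`|H| + 1)) `^ alpha^-1.
have d00 : 0 < d0 by rewrite powR_gt0// divr_gt0.
exists (Num.bound (2 / d0)).
have hb := archi_boundP (ltW (divr_gt0 (ltr0Sn R 1) d00)).
have N0 : (0 < Num.bound (2 / d0))%N.
  by rewrite -(ltr_nat R); apply: lt_trans hb; rewrite divr_gt0.
split=> // d /andP[d_ge0 dN].
have dd0 : d <= d0.
  apply: le_trans dN _; rewrite ler_pdivrMr ?ltr0n// mulrC -ler_pdivrMr//.
  exact: ltW.
have : d `^ alpha <= e / (`|H| + 1).
  have -> : e / (`|H| + 1) = d0 `^ alpha.
    by rewrite -powRrM mulVf ?gt_eqF// powRr1// divr_ge0// ltW.
  by apply: ge0_ler_powR; rewrite ?nnegrE// ltW.
rewrite ler_pdivlMr//; have := powR_ge0 d alpha; have := ler_norm H; nra.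
Qed.

Lemma measure_box_le1 (R : realType) (p q r s : R) :
  p <= q -> q - p <= 1 -> r <= s -> s - r <= 1 ->
  ((@lebesgue_measure R \x @lebesgue_measure R) (box p q r s) <= 1)%E.
Proof.
have mitv (a b : R) : a <= b -> b - a <= 1 ->
    (lebesgue_measure (`[a, b] : set R) <= 1)%E.
  move=> ab ab1; rewrite lebesgue_measure_itv/= lte_fin; case: ltP => _.
    by rewrite -EFinB lee_fin.
  exact: lee01.
move=> pq pq1 rs rs1; rewrite product_measure1E//.
by rewrite -[1%E]mule1 lee_pmul// mitv.
Qed.

(** Lets integrals of nonnegative functions on the torus be bounded by integrals over the plane,
    where Tonelli's theorem is applied. *)
Lemma torus_measure_le (R : realType) (A : set (R * R)) :
  measurable (A : set (measurableTypeR R * measurableTypeR R)) ->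
  (@torus_measure R A <= (@lebesgue_measure R \x @lebesgue_measure R) A)%E.
Proof.
move=> mA.
have mAD := measurableI _ _ mA (@measurable_fundamental_domain R).
exact: (@le_measure _ _ _ (@lebesgue_measure R \x @lebesgue_measure R)%E
  _ _ (mem_set mAD) (mem_set mA) (@subIsetl _ _ _)).
Qed.

Lemma enorm_le (R : realType) (v : R * R) : enorm v <= `|v.1| + `|v.2|.
Proof.
rewrite /enorm -[leRHS]ger0_norm ?addr_ge0// -sqrtr_sqr ler_wsqrtr//.
rewrite sqrrD !real_normK ?num_real// addrAC lerDl mulrn_wge0// mulr_ge0.
Qed.

Lemma norm_fst_le_enorm (R : realType) (v : R * R) : `|v.1| <= enorm v.
Proof. by rewrite -sqrtr_sqr ler_wsqrtr// lerDl sqr_ge0. Qed.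

Lemma norm_snd_le_enorm (R : realType) (v : R * R) : `|v.2| <= enorm v.
Proof. by rewrite -sqrtr_sqr ler_wsqrtr// lerDr sqr_ge0. Qed.

Lemma grid_cell (R : realType) (N : nat) (x : R) : (0 < N)%N -> 0 <= x < 1 ->
  exists a : 'I_N, x \in `[a%:R / N%:R, a.+1%:R / N%:R].
Proof.
move=> N0 /andP[x0 x1]; have N0' : 0 < N%:R :> R by rewrite ltr0n.
have xN : 0 <= x * N%:R by rewrite mulr_ge0// ltW.
have /andP[lo hi] := truncn_itv xN.
have aN : (Num.truncn (x * N%:R) < N)%N.
  rewrite -(ltr_nat R); apply: le_lt_trans lo _.
  by rewrite gtr_pMl.
exists (Ordinal aN) => /=; rewrite in_itv/= ler_pdivrMr// ler_pdivlMr// lo/=.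
exact: ltW.
Qed.

(** Cells are closed, to suit the bounds on closed segments; neighbours overlap along edges, which
    is harmless for upper bounds. *)
Definition cell_box (R : realType) (N : nat) (a : 'I_N * 'I_N) : set (R * R) :=
  box (a.1%:R / N%:R) (a.1.+1%:R / N%:R) (a.2%:R / N%:R) (a.2.+1%:R / N%:R).

Lemma cell_box_enorm (R : realType) (N : nat) (a : 'I_N * 'I_N) (z w : R * R) :
  (0 < N)%N -> cell_box a z -> cell_box a w ->
  0 <= enorm (z - w) <= 2 / N%:R.
Proof.
move=> N0 [/=]; rewrite !in_itv/= => /andP[z1 z2] /andP[z3 z4].
move=> [/=]; rewrite !in_itv/= => /andP[w1 w2] /andP[w3 w4].
rewrite sqrtr_ge0/=; apply: le_trans (enorm_le _) _ => /=.
have -> : 2 / N%:R = N%:R^-1 + N%:R^-1 :> R by rewrite mulrDl mul1r.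
move: z2 z4 w2 w4; rewrite !mulrSr !mulrDl !mul1r => z2 z4 w2 w4.
by apply: lerD; rewrite ler_norml; apply/andP; split; lra.
Qed.

(** The measurable majorant [u] stands in for the integrand cut off to [T], so that no measurability
    of [T] enters. The two terms of the constant cover the two cases: the cell meets [T] where
    [|g| <= delta], or it does not. *)
Lemma integral_cell_bound (R : realType) (g : R * R -> R) (T : set (R * R))
    (alpha delta m H : R) (N : nat) (a : 'I_N * 'I_N) :
  (forall z, differentiable g z) ->
  (forall x y, `|'D_((1, 0) : R * R) g x - 'D_((1, 0) : R * R) g y|
     <= H * enorm (x - y) `^ alpha) ->
  (forall x y, `|'D_((0, 1) : R * R) g x - 'D_((0, 1) : R * R) g y|
     <= H * enorm (x - y) `^ alpha) ->
  0 < delta -> 0 < m ->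
  (forall x, `|g x| <= delta -> T x -> m <= enorm (grad g x)) ->
  (forall d, 0 <= d <= 2 / N%:R -> H * d `^ alpha <= m / 4) ->
  forall beta, 0 < beta ->
  exists u : measurableTypeR R * measurableTypeR R -> \bar R,
    [/\ measurable_fun setT u, forall z, (0 <= u z)%E,
      forall z, cell_box a z -> T z -> ((expR (- (beta * `|g z|)))%:E <= u z)%E
    & (\int[lebesgue_measure \x lebesgue_measure]_z u z
       <= ((16 * pi / m + delta^-1) / beta)%:E)%E].
Proof.
move=> dg H1 H2 delta0 m0 gm Hd beta beta0.
have N0 : (0 < N)%N by apply: leq_ltn_trans (ltn_ord a.1).
have N0' : 0 < N%:R :> R by rewrite ltr0n.
have NV : (N%:R^-1 : R) <= 1 by rewrite invf_le1// ler1n.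
have NV0 : 0 < (N%:R^-1 : R) by rewrite invr_gt0.
have width k : k.+1%:R / N%:R - k%:R / N%:R = N%:R^-1 :> R.
  by rewrite mulrSr mulrDl mul1r addrAC subrr add0r.
have lt k : k%:R / N%:R < k.+1%:R / N%:R :> R by rewrite -subr_gt0 width.
have mE : measurable_fun setT (EFin \o
    (fun z : measurableTypeR R * measurableTypeR R =>
      expR (- (beta * `|g z|)))).
  by apply/measurable_EFinP; exact: measurable_fun_expRN_norm.
have mB : measurable (cell_box a : set (measurableTypeR R * measurableTypeR R)).
  exact: measurable_box.
have pi0 : 0 <= 16 * pi / m :> R by rewrite divr_ge0 ?mulr_ge0 ?pi_ge0// ltW.
have [[x0 [bx0 Tx0 gx0]]|bad] :=
    pselect (exists x0, [/\ cell_box a x0, T x0 & `|g x0| <= delta]);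
  last first.
  (* Here [|g| > delta] on the part of [T] in the cell, so a constant majorant suffices. *)
  exists ((cst (expR (- (beta * delta)))%:E) \_ (cell_box a)); split.
  - exact/(measurable_restrictT _ _).1/measurable_cst.
  - by move=> z; rewrite patchE; case: ifP => //; rewrite lee_fin expR_ge0.
  - move=> z bz Tz; rewrite patchE mem_set// lee_fin ler_expR lerN2 ler_pM2l//.
    by rewrite leNgt; apply/negP => /ltW gz; apply: bad; exists z.
  rewrite -integral_mkcond integral_cst//.
  have mb1 : ((@lebesgue_measure R \x @lebesgue_measure R) (cell_box a) <= 1)%E.
    by apply: measure_box_le1; rewrite ?width// ltW.
  apply: (@le_trans _ _ ((expR (- (beta * delta)))%:E * 1)%E).
    by apply: lee_wpmul2l => //; rewrite lee_fin expR_ge0.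
  rewrite mule1 lee_fin; apply: (@le_trans _ _ (delta^-1 / beta)); last first.
    by rewrite ler_pM2r ?invr_gt0// lerDr.
  (* [exp (- t) <= 1 / t] for [t = beta * delta]. *)
  rewrite -invfM expRN lef_pV2 ?posrE ?expR_gt0 ?mulr_gt0// mulrC.
  by have := expR_ge1Dx (beta * delta); lra.
(* Here the majorant is the integrand on the whole cell, regardless of [T]. *)
exists ((EFin \o (fun z => expR (- (beta * `|g z|)))) \_ (cell_box a)); split.
- apply/(measurable_restrictT _ _).1 => //; exact: measurable_funTS.
- by move=> z; rewrite patchE; case: ifP => //; rewrite lee_fin expR_ge0.
- by move=> z bz Tz; rewrite patchE mem_set.
rewrite -integral_mkcond.
apply: (@le_trans _ _ (4 * pi / (m / 4) / beta)%:E); last first.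
  rewrite lee_fin ler_pM2r ?invr_gt0// invf_div mulrA [4 * pi * 4]mulrAC -natrM.
  by rewrite lerDl invr_ge0 ltW.
have m4 : 0 < m / 4 by rewrite divr_gt0.
have close z : cell_box a z ->  H * enorm (x0 - z) `^ alpha <= m / 4.
  by move=> bz; apply: Hd; exact: cell_box_enorm bz.
(* The gradient at [x0] has norm at least [m], so one partial derivative there is at least [m / 2]
   in absolute value; oscillation at most [m / 4] leaves [m / 4] on the whole cell. *)
have [d1|d2] : m / 2 <= `|'D_((1, 0) : R * R) g x0|
    \/ m / 2 <= `|'D_((0, 1) : R * R) g x0|.
  have := le_trans (gm _ gx0 Tx0) (enorm_le _) => /= h.
  by case: (leP (m / 2) `|'D_((1, 0) : R * R) g x0|) => h1; [left|right; lra].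
- apply: integral_box_exp_le1; rewrite ?width// => z bz.
  have := le_trans (H1 x0 z) (close _ bz).
  have := lerB_dist ('D_((1, 0) : R * R) g x0) ('D_((1, 0) : R * R) g z).
  by lra.
- apply: integral_box_exp_le2; rewrite ?width// => z bz.
  have := le_trans (H2 x0 z) (close _ bz).
  have := lerB_dist ('D_((0, 1) : R * R) g x0) ('D_((0, 1) : R * R) g z).
  by lra.
Qed.

(** Sum the majorants over all cells. The mesh is fixed before [beta], so the number of cells enters
    only the constant. *)
Lemma integral_transversal_bound (R : realType) (g : R * R -> R)
    (T : set (R * R)) (alpha delta m H : R) :
  (forall z, differentiable g z) ->
  (forall x y, `|'D_((1, 0) : R * R) g x - 'D_((1, 0) : R * R) g y|
     <= H * enorm (x - y) `^ alpha) ->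
  (forall x y, `|'D_((0, 1) : R * R) g x - 'D_((0, 1) : R * R) g y|
     <= H * enorm (x - y) `^ alpha) ->
  0 < alpha -> 0 < delta -> 0 < m ->
  (forall x, `|g x| <= delta -> T x -> m <= enorm (grad g x)) ->
  exists C, 0 <= C /\ forall beta, 0 < beta ->
  exists u : measurableTypeR R * measurableTypeR R -> \bar R,
    [/\ measurable_fun setT u, forall z, (0 <= u z)%E,
      forall z, fundamental_domain z -> T z ->
        ((expR (- (beta * `|g z|)))%:E <= u z)%E
    & (\int[@torus_measure R]_z u z <= (C / beta)%:E)%E].
Proof.
move=> dg H1 H2 alpha0 delta0 m0 gm.
have [N [N0 hN]] := small_powR H alpha0 (divr_gt0 m0 (ltr0Sn R 3)).
have c0 : 0 <= 16 * pi / m + delta^-1.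
  by rewrite addr_ge0 ?invr_ge0 ?divr_ge0 ?mulr_ge0 ?pi_ge0// ltW.
exists ((16 * pi / m + delta^-1) *+ #|{: 'I_N * 'I_N}|); split.
  exact: mulrn_wge0.
move=> beta beta0.
have /choice[u hu] := fun a : 'I_N * 'I_N =>
  integral_cell_bound a dg H1 H2 delta0 m0 gm hN beta0.
have u0 a z : (0 <= u a z)%E by case: (hu a).
have mu a : measurable_fun setT (u a) by case: (hu a).
have msum : measurable_fun setT (fun z => \sum_(a : 'I_N * 'I_N) u a z)%E.
  exact: emeasurable_sum.
exists (fun z => \sum_(a : 'I_N * 'I_N) u a z)%E; split => //.
- by move=> z; apply: sume_ge0.
- move=> [x y] [/=]; rewrite !in_itv/= => x01 y01 Tz.
  have [a ax] := grid_cell N0 x01; have [b bY] := grid_cell N0 y01.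
  case: (hu (a, b)) => _ _ /(_ (x, y)) h _.
  apply: (le_trans (h _ Tz)); first by split.
  by rewrite (bigD1 (a, b))//= leeDl// sume_ge0.
- apply: (@le_trans _ _ (\int[lebesgue_measure \x lebesgue_measure]_z
      (\sum_(a : 'I_N * 'I_N) u a z))%E).
    apply: ge0_le_measure_integral => //; first exact: torus_measure_le.
    by move=> z; apply: sume_ge0.
  rewrite ge0_integral_sum//.
  apply: (@le_trans _ _ (\sum_(a : 'I_N * 'I_N)
      ((16 * pi / m + delta^-1) / beta)%:E)%E).
    by apply: lee_sum => a _; case: (hu a).
  by rewrite sumEFin lee_fin sumr_const -mulrnAl.
Qed.

(** * Pointwise smoothing error *)

Lemma le_max_jump (R : realType) (K : nat) (c : 'I_K -> R) (i j : 'I_K) :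
  `|c i - c j| <= max_jump c.
Proof.
rewrite /max_jump; apply: le_trans (le_bigmax _ _ i).
exact: (le_bigmax _ (fun j => `|c i - c j|) j).
Qed.

Lemma max_jump_ge0 (R : realType) (K : nat) (c : 'I_K -> R) : 0 <= max_jump c.
Proof. exact: bigmax_ge_id. Qed.

(** Strict inequalities make the sets [Omega] disjoint, so one indicator survives. *)
Lemma omega0E (R : realType) (K : nat) (phi : 'I_K -> R * R -> R)
    (c : 'I_K -> R) (k : 'I_K) (x : R * R) :
  Omega phi k x -> omega0 phi c x = c k.
Proof.
move=> kx; rewrite /omega0 (bigD1 k)//= big1 ?addr0 => [|j jk].
  by rewrite indicE mem_set ?mulr1.
rewrite indicE memNset ?mulr0// => jx.
have := lt_trans (jx k _) (kx j jk).
by rewrite ltxx eq_sym => /(_ jk).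
Qed.

(** Take [j] maximizing [phi] among the indices other than [k]; such indices exist since
    [K >= 2]. *)
Lemma runner_up (R : realType) (K : nat) (phi : 'I_K -> R * R -> R)
    (k : 'I_K) (x : R * R) : (2 <= K)%N -> Omega phi k x ->
  exists j, [/\ k != j, top_pair phi k j x
    & forall l, l != k -> phi l x <= phi j x].
Proof.
move=> K2 kx.
have [j0 j0k] : exists j0 : 'I_K, j0 != k.
  have : (0 < #|predC1 k|)%N by rewrite cardC1 card_ord -subn1 subn_gt0.
  by move=> /card_gt0P[j]; rewrite inE; exists j.
pose j := [arg max_(i > j0 | i != k) phi i x]%O.
have [jk hj] : j != k /\ forall l, l != k -> phi l x <= phi j x.
  by rewrite /j; case: arg_maxP.
exists j; split => //; first by rewrite eq_sym.
by move=> l lk lj; split; [exact: ltW (kx _ lk)|exact: hj].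
Qed.

(* On [Omega_k] the smoothing error is a combination of the jumps [c j - c k]
   with Gibbs weights at most [exp (- beta (phi k - phi j))]. *)
Lemma omega0_beta_error (R : realType) (K : nat) (phi : 'I_K -> R * R -> R)
    (c : 'I_K -> R) (beta : R) (k : 'I_K) (x : R * R) :
  (2 <= K)%N -> 0 < beta -> Omega phi k x ->
  exists j, [/\ k != j, top_pair phi k j x
    & `|omega0_beta phi c beta x - omega0 phi c x|
      <= K%:R * max_jump c * expR (- (beta * `|phi k x - phi j x|))].
Proof.
move=> K2 beta0 kx; have [j [kj tkj jmax]] := runner_up K2 kx.
exists j; split => //; rewrite (omega0E c kx) /omega0_beta.
set S := \sum_(j < K) expR (beta * phi j x).
have ek : expR (beta * phi k x) <= S.
  by rewrite /S (bigD1 k)//= lerDl sumr_ge0// => i _; rewrite expR_ge0.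
have S0 : 0 < S by apply: lt_le_trans ek; rewrite expR_gt0.
(* The Gibbs weights sum to 1. *)
have -> : c k = \sum_(i < K) c k * (expR (beta * phi i x) / S).
  by rewrite -mulr_sumr -mulr_suml divff ?mulr1// gt_eqF.
rewrite -sumrB; apply: le_trans (ler_norm_sum _ _ _) _.
have -> : K%:R * max_jump c * expR (- (beta * `|phi k x - phi j x|))
    = \sum_(i < K) (max_jump c * expR (- (beta * `|phi k x - phi j x|))).
  by rewrite sumr_const card_ord -mulrA mulr_natl.
apply: ler_sum => i _; rewrite -mulrBl normrM.
have [->|ik] := eqVneq i k.
  by rewrite subrr normr0 mul0r mulr_ge0 ?expR_ge0 ?max_jump_ge0.
apply: ler_pM => //; first exact: le_max_jump.
rewrite ger0_norm; last by rewrite divr_ge0 ?expR_ge0 ?ltW.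
(* Keep only the term [k] of the denominator [S]; then [phi i <= phi j] because [i] differs from
   [k]. *)
apply: (@le_trans _ _ (expR (beta * phi i x) / expR (beta * phi k x))).
  by rewrite ler_pM2l ?expR_gt0// lef_pV2 ?posrE// expR_gt0.
rewrite -expRN -expRD ler_expR gtr0_norm ?subr_gt0; last first.
  by apply: kx; rewrite eq_sym.
by have := jmax _ ik; nra.
Qed.

(** * Measurability of the sharp and smoothed profiles *)

Section markers_measurable.
Context (R : realType) (K : nat) (phi : 'I_K -> R * R -> R).
Hypothesis cphi : forall k, continuous (phi k).

Let TT := (measurableTypeR R * measurableTypeR R)%type.

Lemma measurable_Omega (k : 'I_K) : measurable (Omega phi k : set TT).
Proof.
have -> : Omega phi k = \bigcap_(j in [set j | j != k])
    [set x | 0 < phi k x - phi j x].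
  by apply/seteqP; split=> x /= kx j /kx /=; rewrite subr_gt0.
apply: fin_bigcap_measurable => [|j _]; first exact: finite_finset.
apply: open_measurable_prod.
apply: (@open_comp _ _ (fun x => phi k x - phi j x) [set y | 0 < y]).
  by move=> x _; apply: cvgB; exact: cphi.
exact: open_gt.
Qed.

Lemma measurable_omega0 (c : 'I_K -> R) :
  measurable_fun setT (omega0 phi c : TT -> measurableTypeR R).
Proof.
apply: measurable_sum => k; apply: measurable_funM => //.
by apply: measurable_indic; exact: measurable_Omega.
Qed.

Lemma measurable_omega0_beta (c : 'I_K -> R) (beta : R) :
  measurable_fun setT (omega0_beta phi c beta : TT -> measurableTypeR R).
Proof.
have mexp j : measurable_fun setT
    ((fun x => expR (beta * phi j x)) : TT -> measurableTypeR R).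
  apply: measurableT_comp => //; apply: measurable_funM => //.
  exact: continuous_measurable_prod.
apply: measurable_sum => k; apply: measurable_funM => //.
(* The denominator is positive, so its inverse is a composition of the measurable functions [expR]
   and [ln]. *)
have E x : (\sum_(j < K) expR (beta * phi j x))^-1
    = expR (- ln (\sum_(j < K) expR (beta * phi j x))).
  rewrite expRN lnK// posrE (bigD1 k)//= ltr_pwDl ?expR_gt0//.
  by rewrite sumr_ge0// => j _; rewrite expR_ge0.
under eq_fun do rewrite E.
apply: measurable_funM; first exact: mexp.
apply: measurableT_comp => //; apply: measurableT_comp => //.
apply: measurableT_comp; first exact: measurable_ln.
exact: measurable_sum.
Qed.

End markers_measurable.

(** * Assembly of the L1 estimate *)

(** The majorants dominate only on the fundamental domain; outside it the restricted measure
    vanishes. *)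
Lemma torus_measure_ae_fundamental_domain (R : realType) :
  {ae @torus_measure R, forall x, fundamental_domain x}.
Proof.
exists (~` @fundamental_domain R); split => //.
- by apply: measurableC; exact: measurable_fundamental_domain.
- by rewrite /torus_measure /= /mrestr setICl measure0.
Qed.

(** Each partial derivative is a coordinate of the gradient and inherits its Hölder bound; the
    constants of the two markers add. *)
Lemma gap_Holder (R : realType) (alpha : R) (f h : R * R -> R) :
  C1alpha_torus alpha f -> C1alpha_torus alpha h ->
  (forall z, differentiable (fun y => f y - h y) z) /\
  exists H, (forall x y,
    `|'D_((1, 0) : R * R) (fun z => f z - h z) x
      - 'D_((1, 0) : R * R) (fun z => f z - h z) y|
     <= H * enorm (x - y) `^ alpha) /\
   (forall x y,
    `|'D_((0, 1) : R * R) (fun z => f z - h z) x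
      - 'D_((0, 1) : R * R) (fun z => f z - h z) y|
     <= H * enorm (x - y) `^ alpha).
Proof.
move=> [_ df [H1 Hf]] [_ dh [H2 Hh]]; split.
  by move=> z; exact: differentiableB.
have DB v x : 'D_v (fun z => f z - h z) x = 'D_v f x - 'D_v h x.
  by apply: deriveB; exact: diff_derivable.
exists (H1 + H2); split=> x y; rewrite !DB mulrDl.
- have := le_trans (norm_fst_le_enorm _) (Hf x y).
  have := le_trans (norm_fst_le_enorm _) (Hh x y).
  set a := _ * _; set b := _ * _ => /=; rewrite !ler_norml.
  by move=> /andP[? ?] /andP[? ?]; apply/andP; split; lra.
- have := le_trans (norm_snd_le_enorm _) (Hf x y).
  have := le_trans (norm_snd_le_enorm _) (Hh x y).
  set a := _ * _; set b := _ * _ => /=; rewrite !ler_norml.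
  by move=> /andP[? ?] /andP[? ?]; apply/andP; split; lra.
Qed.

Theorem proposition4p1 (R : realType) (K : nat) (alpha delta m : R)
    (phi : 'I_K -> R * R -> R) :
  (2 <= K)%N ->
  0 < alpha < 1 ->
  (forall k : 'I_K, C1alpha_torus alpha (phi k)) ->
  (@torus_measure R).-negligible
    (~` \bigcup_(k in [set: 'I_K]) Omega phi k) ->
  0 < delta -> 0 < m ->
  (forall i j : 'I_K, i != j ->
     forall x : R * R,
       `|phi i x - phi j x| <= delta -> top_pair phi i j x ->
       m <= enorm (grad (fun y => phi i y - phi j y) x)) ->
  exists C : R, 0 < C /\
    forall (c : 'I_K -> R) (beta : R), 1 <= beta ->
      ('N[@torus_measure R]_1
         [EFin \o (omega0_beta phi c beta \- omega0 phi c)%R]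
       <= (C / beta * max_jump c)%:E)%E.
Proof.
move=> K2 /andP[alpha0 _] Cphi negl delta0 m0 gm.
have cphi k : continuous (phi k).
  by case: (Cphi k) => _ d _ z; exact: differentiable_continuous.
have /choice[C hC] (p : 'I_K * 'I_K) : exists C, 0 <= C /\
    forall beta, 0 < beta ->
    exists u : measurableTypeR R * measurableTypeR R -> \bar R,
    [/\ measurable_fun setT u, forall z, (0 <= u z)%E,
      forall z, fundamental_domain z -> p.1 != p.2 -> top_pair phi p.1 p.2 z ->
        ((expR (- (beta * `|phi p.1 z - phi p.2 z|)))%:E <= u z)%E
    & (\int[@torus_measure R]_z u z <= (C / beta)%:E)%E].
  have [dg [H [H1 H2]]] := gap_Holder (Cphi p.1) (Cphi p.2).
  (* Putting [p.1 != p.2] into the set makes the gradient condition vacuous for diagonal pairs, so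
     all pairs can be treated alike. *)
  have [x|C [C0 hC]] := @integral_transversal_bound R _
    [set x | p.1 != p.2 /\ top_pair phi p.1 p.2 x] alpha delta m H
    dg H1 H2 alpha0 delta0 m0.
    by move=> gx [pne tx]; exact: gm.
  exists C; split=> // beta /hC[u [mu u0 uT iu]]; exists u; split=> //.
  by move=> z Dz pne tz; apply: uT.
have C_ge0 p : 0 <= C p by case: (hC p).
(* [K] counts the terms of the smoothing error; the sum over pairs is there because the runner-up
   varies with the point; adding 1 ensures positivity. *)
exists (K%:R * (\sum_p C p) + 1); split.
  by rewrite ltr_wpDl// mulr_ge0// sumr_ge0.
move=> c beta beta1; have beta0 : 0 < beta by apply: lt_le_trans beta1.
have /choice[u hu] p := (hC p).2 beta beta0.
have u0 p z : (0 <= u p z)%E by case: (hu p).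
have mu p : measurable_fun setT (u p) by case: (hu p).
have J0 := max_jump_ge0 c.
have KJ0 : 0 <= K%:R * max_jump c by rewrite mulr_ge0.
have msum : measurable_fun setT (fun z => \sum_p u p z)%E.
  exact: emeasurable_sum.
have sum0 z : (0 <= \sum_p u p z)%E by exact: sume_ge0.
rewrite Lnorm1.
apply: (@le_trans _ _ (\int[@torus_measure R]_z
    ((K%:R * max_jump c)%:E * \sum_p u p z))%E).
  apply: ae_ge0_le_integral => //.
  - apply: measurableT_comp => //; apply/measurable_EFinP.
    apply: measurable_funB.
      exact: measurable_omega0_beta.
    exact: measurable_omega0.
  - by move=> z _; rewrite mule_ge0// lee_fin.
  - exact: measurable_funeM.
  (* Almost every point lies in some [Omega k] and in the fundamental domain; there the majorant of
     the pair [(k, j)] alone already dominates. *)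
  - have aeO : {ae @torus_measure R, forall z,
        (\bigcup_(k in [set: 'I_K]) Omega phi k) z} by [].
    move: aeO (@torus_measure_ae_fundamental_domain R).
    apply: (@filterS2 _ _ (ae_filter_ringOfSetsType (@torus_measure R))).
    move=> z [k _ kz] Dz _.
    have [j [kj tkj le]] := omega0_beta_error c K2 beta0 kz.
    apply: (@le_trans _ _ (K%:R * max_jump c
      * expR (- (beta * `|phi k z - phi j z|)))%:E); first by rewrite lee_fin.
    rewrite EFinM lee_wpmul2l ?lee_fin//.
    have [_ _ /(_ z Dz kj tkj) h _] := hu (k, j).
    by apply: le_trans h _; rewrite (bigD1 (k, j))//= leeDl// sume_ge0.
rewrite ge0_integralZl_EFin// ge0_integral_sum//.
apply: (@le_trans _ _ ((K%:R * max_jump c)%:E * \sum_p (C p / beta)%:E)%E).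
  apply: lee_wpmul2l; first by rewrite lee_fin.
  by apply: lee_sum => p _; case: (hu p).
rewrite sumEFin -EFinM lee_fin -mulr_suml.
have -> : K%:R * max_jump c * ((\sum_p C p) / beta)
   = K%:R * (\sum_p C p) / beta * max_jump c by ring.
by rewrite ler_wpM2r// ler_pM2r ?invr_gt0// lerDl.
Qed.
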